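(* Let $a,b,c \geq 0$ be integers and let $L = \{1^a,4^b,5^c\}$ be an admissible multiset. Then $L$ has a realization.
   Context: Multisets: exponents denote multiplicity, so $\{1^a,4^b,5^c\}$ contains $a$ copies of $1$, $b$ copies of $4$ and $c$ copies of $5$. The underlying set of a multiset is the set of its distinct elements. Realizations: $K_v$ is the complete graph on the vertex set $\{0,1,\ldots,v-1\}$. The length of the edge between $x$ and $y$ in $K_v$ is $\ell(x,y)=\min(|x-y|,\,v-|x-y|)$. A realization of a multiset $L$ of size $v-1$ is a Hamiltonian path $[h_1,\ldots,h_v]$ in $K_v$ such that the multiset $\{\ell(h_i,h_{i+1}) : 1\le i\le v-1\}$ equals $L$. Admissibility: a multiset $L$ of size $v-1$ is admissible if its underlying set is contained in $\{1,\ldots,\lfloor v/2\rfloor\}$ and for every divisor $d$ of $v$ the number of multiples of $d$ appearing in $L$ (with multiplicity) is at most $v-d$. *)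

(* Defs.v *)
From mathcomp Require Import all_boot all_order all_algebra.

Set Implicit Arguments.
Unset Strict Implicit.
Unset Printing Implicit Defensive.

(* A finite multiset of naturals is represented by a sequence up to [perm_eq]:
   the predicates on [L] below do not depend on the order of its items. *)

Definition complete_graph (v : nat) : rel 'I_v := fun x y => x != y.

Definition hamiltonian_path (T : finType) (e : rel T) (h : seq T) : Prop :=
  [/\ sorted e h, uniq h & forall x : T, x \in h].

Definition edge_length (v : nat) (x y : 'I_v) : nat :=
  minn `|(x : nat) - (y : nat)|%N (v - `|(x : nat) - (y : nat)|%N)%N.

Definition edge_lengths (v : nat) (h : seq 'I_v) : seq nat :=
  if h is x :: s then pairmap (@edge_length v) x s else [::].

(* [(size L).+1 = v] says that [L] has size [v - 1] and also forces [0 < v]. *)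
Definition realization (v : nat) (L : seq nat) (h : seq 'I_v) : Prop :=
  [/\ (size L).+1 = v,
      hamiltonian_path (@complete_graph v) h &
      perm_eq (edge_lengths h) L].

Definition admissible (v : nat) (L : seq nat) : Prop :=
  [/\ (size L).+1 = v,
      forall l, l \in L -> (1 <= l <= v./2)%N &
      forall d, (d %| v)%N -> (count (fun l => d %| l)%N L <= v - d)%N].

(* Main.v *)
Require Import Defs.
From mathcomp Require Import all_boot all_order all_algebra.
From mathcomp Require Import zify.

Set Implicit Arguments.
Unset Strict Implicit.
Unset Printing Implicit Defensive.

(** Realizations can be grown.  Take a Hamiltonian path of K_v and a cut between
    the vertices m and m+1 such that the only edges crossing the cut are
    - edges of length x joining u <= m to u + x > m, one for each of the x vertices
      m+1, ..., m+x as upper end;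
    - edges that are long as differences, so that their length v - |u - w| is
      measured the other way round the cycle.
    Insert x new vertices m+1, ..., m+x, moving the old vertices above m up by x.
    A long edge crossing the cut is stretched by x, exactly as v is, so its length
    does not change; an edge on one side of the cut keeps its difference.  An edge
    {u, u + x} across the cut is stretched to {u, u + 2x}, whose middle point is
    one of the new vertices: routing the path through it replaces one edge of
    length x by two.  The result is a Hamiltonian path of K_(v+x) realizing the
    old multiset with x further copies of x ([grow_vertices], [grow_lengths]), and
    it can be grown again, both at the same cut ([growable_again]) and at any cut
    that served another length y ([growable_other]).

    Hence a path with growth cuts for the lengths in X realizes not just its own
    multiset {1^a, 4^b, 5^c} but also every {1^(a+i), 4^(b+4j), 5^(c+5k)} where i
    (resp. j, k) is 0 unless 1 (resp. 4, 5) is in X.  So the triples (a, b, c) split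
    into finitely many families: beyond fixed thresholds only the residues of
    b mod 4 and c mod 5 matter.  Admissibility is compatible with this reduction
    ([possible_cap]), because the only divisors of v that restrict {1^a, 4^b, 5^c} are
    2, 4 and 5; the first two only bound a + c from below and depend on b modulo 4,
    the last only bounds a + b from below and depends on c modulo 5.  An explicit
    finite list of growable paths, [bases], then meets every admissible family
    ([bases_cover]). *)

(** * Lengths of the edges of a path of natural numbers *)

Definition lo (e : nat * nat) := minn e.1 e.2.
Definition hi (e : nat * nat) := maxn e.1 e.2.
Definition width e := hi e - lo e.
Definition cyclic_length v e := minn (width e) (v - width e).
Definition edges (h : seq nat) := if h is u :: s then pairmap pair u s else [::].
Definition path_lengths h := [seq cyclic_length (size h) e | e <- edges h].

Lemma size_edges h : size (edges h) = (size h).-1.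
Proof. by case: h => //= u s; rewrite size_pairmap. Qed.

Lemma edges_snd u s : [seq e.2 | e <- edges (u :: s)] = s.
Proof. by elim: s u => //= w s IHs u; rewrite IHs. Qed.

Lemma lo_le_hi e : lo e <= hi e.
Proof. by rewrite geq_min leq_maxl. Qed.

(** * Growing a path at a cut *)

Definition crosses m e := lo e <= m < hi e.
Definition cut x m e := crosses m e && (width e == x).

(** Inserting x vertices above m must not change the length of an edge that is not
    going to be subdivided.  One inequality is strict and the other weak, so that an
    edge of width v / 2 never counts as long: if it could be short for one cut and
    long for another, growing at the first would spoil the second. *)
Definition rigid v x m e :=
  if crosses m e then (width e == x) || (v < (width e).*2) else (width e).*2 <= v.

(** The last condition says that each of the x new vertices is the middle of
    exactly one stretched edge: the new vertex splitting {u, u + x} is numbered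
    u + x, the number that the upper end gives up when it moves. *)
Definition growable x m h :=
  [&& x.*2 <= size h, m < size h, all (rigid (size h) x m) (edges h)
    & perm_eq [seq hi e | e <- edges h & cut x m e] (iota m.+1 x)].

Definition shift x m u := if u <= m then u else u + x.

Definition grow_edge x m e :=
  if cut x m e then [:: (shift x m e.1, hi e); (hi e, shift x m e.2)]
  else [:: (shift x m e.1, shift x m e.2)].

Definition grow x m h :=
  if h is u :: _ then
    shift x m u :: [seq e.2 | e <- flatten [seq grow_edge x m e | e <- edges h]]
  else [::].

(* Facts about a single edge and its image are linear arithmetic, once the
   conditionals are split. *)
Ltac edge_lia :=
  rewrite /grow_edge /cut /rigid /cyclic_length /crosses /width /lo /hi /shift /=;
  repeat case: ifP => /=; lia.

Lemma lo_shift x m e : lo (shift x m e.1, shift x m e.2) = shift x m (lo e).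
Proof. by case: e => u w; edge_lia. Qed.

Lemma hi_shift x m e : hi (shift x m e.1, shift x m e.2) = shift x m (hi e).
Proof. by case: e => u w; edge_lia. Qed.

Lemma edges_grow x m h :
  edges (grow x m h) = flatten [seq grow_edge x m e | e <- edges h].
Proof.
case: h => // u s; rewrite /grow /edges -/(edges _).
elim: s u => //= w s IHs u; rewrite /grow_edge /=.
by case: ifP => _ /=; rewrite IHs.
Qed.

Lemma perm_grow_ends x m l :
  perm_eq [seq e.2 | e <- flatten [seq grow_edge x m e | e <- l]]
          ([seq hi e | e <- l & cut x m e] ++ [seq shift x m e.2 | e <- l]).
Proof.
elim: l => //= e l IHl; rewrite map_cat /grow_edge; case: ifP => _ /=.
  rewrite perm_cons perm_sym (perm_catCA _ [:: _]) /= perm_cons perm_sym.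
  exact: IHl.
by rewrite perm_sym (perm_catCA _ [:: _]) /= perm_cons perm_sym; apply: IHl.
Qed.

Lemma size_grow x m h : growable x m h -> size (grow x m h) = size h + x.
Proof.
case/and4P => _ m_lt _ /perm_size; rewrite size_iota => {2}<-.
case: h m_lt => //= u s _; have /perm_size-> := perm_grow_ends x m (edges (u :: s)).
by rewrite size_cat size_map addnC -addSn size_map -(size_map snd) edges_snd.
Qed.

(** The old vertices fill 0, ..., m and m+x+1, ..., v+x-1; the middle points of the
    stretched edges fill the gap. *)
Lemma grow_vertices x m h : growable x m h ->
  perm_eq h (iota 0 (size h)) ->
  perm_eq (grow x m h) (iota 0 (size (grow x m h))).
Proof.
move=> gr; rewrite (size_grow gr); case/and4P: gr => _ m_lt _ tops perm_h.
have -> : size h + x = m.+1 + (x + (size h - m.+1)) by lia.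
rewrite !iotaD add0n.
have perm_g : perm_eq (grow x m h)
   ([seq hi e | e <- edges h & cut x m e] ++ [seq shift x m u | u <- h]).
  case: h {m_lt tops perm_h} => // u s; rewrite /grow perm_sym /= -cat1s.
  rewrite perm_catCA /= perm_cons perm_sym.
  apply: perm_trans (perm_grow_ends _ _ _) _.
  by rewrite -{4}(edges_snd u s) -map_comp.
apply: perm_trans perm_g _.
rewrite perm_sym perm_catCA perm_sym; apply: perm_cat => //.
apply: perm_trans (perm_map _ perm_h) _.
have {1}-> : size h = m.+1 + (size h - m.+1) by lia.
rewrite iotaD map_cat; apply: perm_cat.
  rewrite (_ : map _ _ = iota 0 m.+1) //.
  rewrite -[RHS]map_id; apply/eq_in_map => u; rewrite mem_iota; edge_lia.
rewrite add0n addnC iotaDl.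
suff /eq_in_map-> : {in iota m.+1 (size h - m.+1), shift x m =1 addn x} by [].
move=> u; rewrite mem_iota; edge_lia.
Qed.

Lemma grow_edge_lengths v x m l : x.*2 <= v -> all (rigid v x m) l ->
  perm_eq [seq cyclic_length (v + x) e | e <- flatten [seq grow_edge x m e | e <- l]]
          (nseq (count (cut x m) l) x ++ [seq cyclic_length v e | e <- l]).
Proof.
move=> xv; elim: l => //= e l IHl /andP[rig_e /IHl {}IHl].
rewrite map_cat.
have [cut_e|ncut_e] := boolP (cut x m e).
  rewrite /grow_edge cut_e /=.
  have -> : cyclic_length (v + x) (shift x m e.1, hi e) = x.
    by case: e cut_e {rig_e} => u w; edge_lia.
  have -> : cyclic_length (v + x) (hi e, shift x m e.2) = x.
    by case: e cut_e {rig_e} => u w; edge_lia.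
  have -> : cyclic_length v e = x.
    by case: e cut_e {rig_e} => u w; edge_lia.
  by rewrite perm_cons perm_sym (perm_catCA _ [:: _]) /= perm_cons perm_sym.
rewrite /grow_edge (negPf ncut_e) /= add0n.
have -> : cyclic_length (v + x) (shift x m e.1, shift x m e.2) = cyclic_length v e.
  by case: e ncut_e rig_e => u w; edge_lia.
by rewrite perm_sym (perm_catCA _ [:: _]) /= perm_cons perm_sym.
Qed.

(** Exactly x edges are subdivided, and each contributes one more length x. *)
Lemma grow_lengths x m h : growable x m h ->
  perm_eq (path_lengths (grow x m h)) (nseq x x ++ path_lengths h).
Proof.
move=> gr; rewrite /path_lengths (size_grow gr) edges_grow.
case/and4P: gr => xv _ rig /perm_size; rewrite size_map size_iota size_filter.
by move=> {3}<-; apply: grow_edge_lengths.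
Qed.

Lemma all_grow_edge (P : pred (nat * nat)) x m l :
  {in l, forall e, all P (grow_edge x m e)} ->
  all P (flatten [seq grow_edge x m e | e <- l]).
Proof.
move=> Pl; apply/allP => e /flatten_mapP[e' l_e' e_e'].
exact: allP (Pl _ l_e') e e_e'.
Qed.

(** The lower half of each subdivided edge crosses the same cut, with the same
    upper end as the edge it comes from. *)
Lemma growable_again x m h : growable x m h -> growable x m (grow x m h).
Proof.
move=> gr; rewrite /growable (size_grow gr) edges_grow.
case/and4P: gr => xv mv rig tops.
apply/and4P; split; [lia | lia | |].
  by apply: all_grow_edge => -[u w] /(allP rig); edge_lia.
rewrite (_ : map _ _ = [seq hi e | e <- edges h & cut x m e]) //.
elim: (edges h) rig {tops} => //= e l IHl /andP[rig_e /IHl {}IHl].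
rewrite filter_cat map_cat IHl.
have [cut_e|ncut_e] := boolP (cut x m e); rewrite /grow_edge ?cut_e ?(negPf ncut_e) /=.
  (* which of the two halves is the lower one depends on the direction in which
     the path runs through the edge *)
  have -> : cut x m (shift x m e.1, hi e) = (e.1 < e.2).
    by case: e cut_e {rig_e} => u w; edge_lia.
  have -> : cut x m (hi e, shift x m e.2) = (e.2 < e.1).
    by case: e cut_e {rig_e} => u w; edge_lia.
  case: e cut_e {rig_e} => u w /=.
  case: (ltngtP u w) => [uw|wu|->] /= cut_e; last by move: cut_e; edge_lia.
    by congr (_ :: _); move: cut_e; edge_lia.
  by congr (_ :: _); move: cut_e; edge_lia.
have -> // : cut x m (shift x m e.1, shift x m e.2) = false.
case: e ncut_e rig_e => u w; edge_lia.
Qed.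

(** An edge of length x subdivided at m cannot cross the cut n of another length:
    it is too short to be long there, and it has the wrong length to be subdivided
    there.  So both its halves lie on one side of n. *)
Lemma rigid_grow_edge v x m y n e : x != y -> x.*2 <= v -> y.*2 <= v ->
  rigid v x m e -> rigid v y n e ->
  all (rigid (v + x) y (shift x m n)) (grow_edge x m e).
Proof.
move=> neq_xy xv yv; rewrite /grow_edge.
have [cut_e|ncut_e] := boolP (cut x m e) => /=.
  move=> _ rigy.
  have -> : rigid (v + x) y (shift x m n) (shift x m e.1, hi e).
    by case: e cut_e rigy => u w; edge_lia.
  have -> // : rigid (v + x) y (shift x m n) (hi e, shift x m e.2).
  by case: e cut_e rigy => u w; edge_lia.
rewrite andbT; move: ncut_e (lo_le_hi e).
rewrite /cut /rigid /crosses /width lo_shift hi_shift.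
by move: (lo e) (hi e) => l h; edge_lia.
Qed.

Lemma cut_grow_edge v x m y n e : x != y -> x.*2 <= v -> y.*2 <= v ->
  rigid v x m e -> rigid v y n e ->
  [seq hi f | f <- grow_edge x m e & cut y (shift x m n) f] =
  if cut y n e then [:: shift x m (hi e)] else [::].
Proof.
move=> neq_xy xv yv; rewrite /grow_edge.
have [cut_e|ncut_e] := boolP (cut x m e) => /=.
  move=> _ rigy.
  have -> : cut y (shift x m n) (shift x m e.1, hi e) = false.
    by case: e cut_e rigy => u w; edge_lia.
  have -> : cut y (shift x m n) (hi e, shift x m e.2) = false.
    by case: e cut_e rigy => u w; edge_lia.
  have -> // : cut y n e = false.
  by case: e cut_e rigy => u w; edge_lia.
move=> rigx rigy.
have -> : cut y (shift x m n) (shift x m e.1, shift x m e.2) = cut y n e.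
  move: ncut_e (lo_le_hi e) rigx rigy.
  rewrite /cut /rigid /crosses /width lo_shift hi_shift.
  by move: (lo e) (hi e) => l h; edge_lia.
by case: ifP => //= _; rewrite hi_shift.
Qed.

(** Growing at m moves the cut n of another length along with the vertices, and the
    window n+1, ..., n+y moves as one block: an edge of length y across n does
    not cross m, hence neither m nor the inserted vertices separate it from n. *)
Lemma growable_other x m y n h : x != y ->
  growable x m h -> growable y n h ->
  growable y (shift x m n) (grow x m h).
Proof.
move=> neq_xy gr; rewrite /growable (size_grow gr) edges_grow.
case/and4P: gr => xv mv rigx _ /and4P[yv nv rigy tops].
have rig e : e \in edges h -> rigid (size h) x m e && rigid (size h) y n e.
  by move=> he; rewrite (allP rigx) ?(allP rigy).
apply/and4P; split; [lia | edge_lia | |].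
  by apply: all_grow_edge => e /rig/andP[]; apply: rigid_grow_edge.
have -> : iota (shift x m n).+1 y = [seq shift x m u | u <- iota n.+1 y].
  have side u : u \in iota n.+1 y -> (u <= m) = (n <= m).
    rewrite -(perm_mem tops) => /mapP[e]; rewrite mem_filter => /andP[].
    move=> cut_e /rig rig_e ->.
    by case: e cut_e rig_e => v w; edge_lia.
  rewrite {1}/shift; case: ifP => nm.
    rewrite -[LHS]map_id; apply/eq_in_map => u /side; edge_lia.
  rewrite -addSn addnC iotaDl; apply/eq_in_map => u /side; edge_lia.
rewrite (_ : map hi _ = [seq shift x m u | u <- [seq hi e | e <- edges h & cut y n e]]).
  exact: perm_map.
elim: (edges h) rig {tops} => //= e l IHl rig.
have /andP[rigx_e rigy_e] := rig e (mem_head _ _).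
rewrite filter_cat map_cat {}IHl => [|e' l_e']; last by rewrite rig // inE l_e' orbT.
by rewrite (cut_grow_edge _ xv yv rigx_e rigy_e) //; case: ifP.
Qed.

(** * Multisets with a growable realization *)

Definition growable_multiset (X : seq nat) L := exists h,
  [/\ size h = (size L).+1, perm_eq h (iota 0 (size h)), perm_eq (path_lengths h) L
    & {in X, forall x, exists m, growable x m h}].

Lemma growable_multiset_perm X L L' :
  perm_eq L L' -> growable_multiset X L -> growable_multiset X L'.
Proof.
move=> LL' [h [sz vert len grX]]; exists h.
by rewrite -(perm_size LL'); split=> //; apply: perm_trans LL'.
Qed.

Lemma growable_multiset_add X L x k : x \in X ->
  growable_multiset X L -> growable_multiset X (nseq (k * x) x ++ L).
Proof.
move=> X_x grL; elim: k => [|k [h [sz vert len grX]]]; first by rewrite mul0n.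
have [m gr_xm] := grX x X_x; exists (grow x m h); split.
- by rewrite size_grow // sz !size_cat !size_nseq mulSn; lia.
- exact: grow_vertices.
- apply: perm_trans (grow_lengths gr_xm) _.
  by rewrite mulSn nseqD -catA perm_cat2l.
move=> y X_y; have [->|neq_yx] := eqVneq y x; first by exists m; apply: growable_again.
have [n gr_yn] := grX y X_y; exists (shift x m n).
by apply: growable_other; rewrite // eq_sym.
Qed.

Lemma edge_length_cyclic v (x y : 'I_v) :
  edge_length x y = cyclic_length v (val x, val y).
Proof.
rewrite /edge_length /cyclic_length /width /lo /hi /=; congr minn; lia.
Qed.

Lemma growable_multiset_realization X L v : growable_multiset X L ->
  (size L).+1 = v -> exists h : seq 'I_v, realization L h.
Proof.
case=> h [sz vert len _] vL; rewrite -{}vL.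
rewrite /path_lengths sz in vert len.
have h_lt u : u \in h -> u < (size L).+1 by rewrite (perm_mem vert) mem_iota.
have uniq_h : uniq h by rewrite (perm_uniq vert) iota_uniq.
pose h' := [seq inord u : 'I_(size L).+1 | u <- h].
have val_h' : map val h' = h.
  rewrite -map_comp -[RHS]map_id; apply/eq_in_map => u /h_lt u_lt.
  exact: inordK.
have uniq_h' : uniq h' by rewrite -(map_inj_uniq val_inj) val_h'.
exists h'; split=> //.
  split=> //; first by apply: pairwise_sorted; rewrite -uniq_pairwise.
  move=> x; rewrite -(mem_map val_inj) val_h' (perm_mem vert) mem_iota.
  exact: ltn_ord.
suff -> : edge_lengths h' = [seq cyclic_length (size L).+1 e | e <- edges h] by [].
rewrite -val_h'; case: (h') => //= x s.
by elim: s x => //= y s IHs x; rewrite IHs edge_length_cyclic.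
Qed.

Definition multiset145 a b c := nseq a 1 ++ nseq b 4 ++ nseq c 5.

Lemma growable_multiset145 X a b c i j k :
  1 \in X \/ i = 0 -> 4 \in X \/ j = 0 -> 5 \in X \/ k = 0 ->
  growable_multiset X (multiset145 a b c) ->
  growable_multiset X (multiset145 (a + i * 1) (b + j * 4) (c + k * 5)).
Proof.
have add L x n : x \in X \/ n = 0 ->
    growable_multiset X L -> growable_multiset X (nseq (n * x) x ++ L).
  by case=> [X_x|->]; [apply: growable_multiset_add | rewrite mul0n].
move=> Xi Xj Xk /(add _ _ _ Xk)/(add _ _ _ Xj)/(add _ _ _ Xi).
apply: growable_multiset_perm; apply/permP => p.
rewrite /multiset145 !count_cat !count_nseq; case: (p 1) (p 4) (p 5) => [] [] []; lia.
Qed.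

(** * Reduction to finitely many triples *)

(** Representative of n when, from t on, only the residue modulo x matters. *)
Definition cap t x n := if n < t then n else t + (n - t) %% x.

Lemma cap_mem t x n : 0 < x -> cap t x n \in iota 0 (t + x).
Proof.
rewrite mem_iota /cap => x_gt0; case: ifP; first lia.
by rewrite ltn_add2l ltn_pmod.
Qed.

Lemma capP t x n :
  n = cap t x n \/ t <= cap t x n /\ exists k, n = cap t x n + k * x.
Proof.
rewrite /cap; case: (ltnP n t) => t_n; [by left | right; split; first exact: leq_addr].
by exists ((n - t) %/ x); rewrite -addnA [_ %% _ + _]addnC -divn_eq subnKC.
Qed.

(** Whether n0 copies of x in a path with growth cuts for X lead to n copies, where
    n is a value of [cap t x].  If n >= t then n stands for infinitely many
    multiplicities, and reaching them all needs growth. *)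
Definition attains (X : seq nat) t x n0 n :=
  (n0 <= n) && (if x \in X then x %| n - n0 else (n == n0) && (n < t)).

Lemma attains_cap X t x n0 n : attains X t x n0 (cap t x n) ->
  exists k, n = n0 + k * x /\ (x \in X \/ k = 0).
Proof.
case/andP; case: (capP t x n) => [<- n0_le|[t_le [q nE]] n0_le].
  case: ifP => [X_x /dvdnP[k nk]|_ /andP[/eqP-> _]]; last first.
    by exists 0; rewrite mul0n addn0; split; [|right].
  by exists k; split; [lia | left].
case: ifP => [X_x /dvdnP[k nk]|_ /andP[]]; last by rewrite ltnNge t_le.
by exists (k + q); split; [rewrite mulnDl; lia | left].
Qed.

(** What admissibility says about the triple (a, b, c): 4 and 5 may occur only if they
    are at most v / 2, and every divisor of 4 or of 5 other than 1 is 2, 4 or 5. *)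
Definition possible a b c :=
  let v := a + b + c + 1 in
  [&& (0 < b) ==> (8 <= v), (0 < c) ==> (10 <= v), (2 %| v) ==> (1 <= a + c),
      (4 %| v) ==> (3 <= a + c) & (5 %| v) ==> (4 <= a + b)].

Lemma admissible_possible a b c v : admissible v (multiset145 a b c) -> possible a b c.
Proof.
case; rewrite /multiset145 !size_cat !size_nseq => vE bound divs.
have half4 : 0 < b -> 4 <= v./2.
  move=> b_gt0; suff /bound/andP[] : 4 \in nseq a 1 ++ nseq b 4 ++ nseq c 5 by [].
  by rewrite !mem_cat !mem_nseq b_gt0 orbT.
have half5 : 0 < c -> 5 <= v./2.
  move=> c_gt0; suff /bound/andP[] : 5 \in nseq a 1 ++ nseq b 4 ++ nseq c 5 by [].
  by rewrite !mem_cat !mem_nseq c_gt0 !orbT.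
have := (divs 2, divs 4, divs 5).
rewrite !count_cat !count_nseq /= ?mul0n ?mul1n => -[[div2 div4] div5].
rewrite /possible; have -> : a + b + c + 1 = v by lia.
apply/and5P; split; apply/implyP.
- by move/half4; lia.
- by move/half5; lia.
- by move=> dvd_v; have := div2 dvd_v; lia.
- by move=> dvd_v; have := div4 dvd_v; lia.
- by move=> dvd_v; have := div5 dvd_v; lia.
Qed.

(** Capping b keeps v modulo 4 and capping c keeps v modulo 5.  If the capped triple
    violated a divisibility condition then the two multiplicities it bounds from
    below would be under their thresholds, hence unchanged, and the original triple
    would violate it too.  The threshold 8 is what makes v >= 10 hold after
    capping a in the presence of a 5. *)
Lemma possible_cap a b c :
  possible a b c -> possible (cap 8 1 a) (cap 9 4 b) (cap 11 5 c).
Proof.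
have := (capP 8 1 a, capP 9 4 b, capP 11 5 c).
move: (cap 8 1 a) (cap 9 4 b) (cap 11 5 c) => a' b' c' [[Ha Hb] Hc].
case/and5P=> p4 p5 d2 d4 d5; apply/and5P; split.
- by case: Ha Hb Hc p4 => [->|[? [i ->]]] [->|[? [j ->]]] [->|[? [k ->]]]; lia.
- by case: Ha Hb Hc p5 => [->|[? [i ->]]] [->|[? [j ->]]] [->|[? [k ->]]]; lia.
- by case: Ha Hb Hc d2 => [->|[? [i ->]]] [->|[? [j ->]]] [->|[? [k ->]]]; lia.
- by case: Ha Hb Hc d4 => [->|[? [i ->]]] [->|[? [j ->]]] [->|[? [k ->]]]; lia.
- by case: Ha Hb Hc d5 => [->|[? [i ->]]] [->|[? [j ->]]] [->|[? [k ->]]]; lia.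
Qed.

(** * The base paths *)

(** Paths are grouped by their growth cuts: a pair (x, m) announces that x vertices
    can be inserted above m.  The paths are the outcome of a computer search for a
    list that satisfies both [bases_ok] and [bases_cover]. *)
Definition base_families : seq (seq (nat * nat) * seq (seq nat)) := [::
  ([:: (1, 0); (4, 4); (5, 9)], [::
    [:: 4; 8; 13; 12; 7; 3; 2; 6; 11; 0; 1; 5; 10; 14; 9];
    [:: 2; 6; 11; 15; 10; 5; 1; 0; 12; 7; 3; 4; 8; 13; 14; 9];
    [:: 2; 6; 11; 16; 12; 7; 3; 4; 8; 13; 0; 1; 5; 10; 15; 14; 9];
    [:: 4; 8; 13; 17; 12; 7; 3; 2; 6; 11; 16; 15; 10; 5; 1; 0; 14; 9];
    [:: 2; 6; 11; 15; 16; 12; 7; 3; 4; 8; 13; 0; 1; 5; 10; 14; 9];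
    [:: 4; 8; 13; 17; 16; 12; 7; 3; 2; 6; 11; 15; 10; 5; 1; 0; 14; 9];
    [:: 4; 8; 13; 12; 7; 3; 2; 6; 11; 0; 1; 5; 10; 15; 14; 9];
    [:: 2; 6; 11; 16; 15; 10; 5; 1; 0; 12; 7; 3; 4; 8; 13; 14; 9];
    [:: 2; 6; 11; 16; 17; 12; 7; 3; 4; 8; 13; 0; 1; 5; 10; 15; 14; 9];
    [:: 2; 6; 11; 16; 17; 12; 7; 3; 4; 8; 13; 18; 19; 15; 0; 1; 5; 10; 14; 9]]);
  ([:: (1, 0); (4, 4); (5, 10)], [::
    [:: 4; 8; 13; 14; 9; 5; 1; 0; 12; 7; 3; 2; 6; 11; 15; 10];
    [:: 2; 6; 11; 16; 12; 7; 3; 4; 8; 13; 0; 1; 5; 9; 14; 15; 10];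
    [:: 2; 6; 11; 16; 17; 12; 7; 3; 4; 8; 13; 18; 14; 9; 5; 1; 0; 15; 10];
    [:: 4; 8; 13; 18; 17; 12; 7; 3; 2; 6; 11; 16; 0; 1; 5; 9; 14; 19; 15; 10];
    [:: 4; 8; 13; 12; 7; 3; 2; 6; 11; 0; 1; 5; 9; 14; 15; 10];
    [:: 4; 8; 13; 14; 9; 5; 1; 0; 12; 7; 3; 2; 6; 11; 16; 15; 10];
    [:: 2; 6; 11; 16; 17; 12; 7; 3; 4; 8; 13; 0; 1; 5; 9; 14; 15; 10]]);
  ([:: (1, 0); (4, 4); (5, 11)], [::
    [:: 4; 8; 13; 18; 14; 9; 5; 1; 0; 15; 10; 11; 16; 17; 12; 7; 3; 2; 6]]);
  ([:: (1, 0); (4, 4); (5, 13)], [::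
    [:: 2; 6; 11; 16; 15; 10; 5; 1; 0; 14; 9; 13; 18; 17; 12; 7; 3; 4; 8]]);
  ([:: (1, 0); (4, 10); (5, 5)], [::
    [:: 6; 1; 0; 11; 7; 2; 3; 8; 12; 13; 9; 4; 5; 10; 14]]);
  ([:: (1, 0); (4, 4)], [::
    [:: 4; 8; 12; 7; 3; 2; 6; 11; 0; 1; 5; 10; 14; 9; 13];
    [:: 4; 8; 13; 9; 5; 1; 0; 12; 7; 3; 2; 6; 11; 15; 10; 14];
    [:: 2; 6; 0; 1; 5; 9; 8; 4; 3; 7];
    [:: 2; 6; 10; 5; 1; 0; 7; 3; 4; 8; 9];
    [:: 2; 6; 11; 7; 3; 4; 8; 0; 1; 5; 10; 9];
    [:: 4; 8; 12; 7; 3; 2; 6; 11; 10; 5; 1; 0; 9];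
    [:: 2; 6; 10; 5; 1; 0; 9; 13; 8; 4; 3; 7; 12; 11];
    [:: 2; 6; 10; 9; 5; 1; 0; 7; 3; 4; 8];
    [:: 2; 6; 11; 7; 3; 4; 8; 0; 1; 5; 9; 10];
    [:: 2; 6; 11; 7; 3; 4; 8; 12; 13; 9; 0; 1; 5; 10];
    [:: 2; 6; 11; 0; 1; 5; 10; 14; 9; 13; 12; 7; 3; 4; 8];
    [:: 4; 8; 12; 11; 7; 3; 2; 6; 10; 5; 1; 0; 9];
    [:: 2; 6; 10; 5; 1; 0; 9; 13; 12; 8; 4; 3; 7; 11];
    [:: 2; 6; 11; 7; 3; 4; 8; 12; 13; 9; 5; 1; 0; 10; 14];
    [:: 0; 1; 5; 9; 13; 14; 10; 15; 11; 6; 2; 3; 7; 12; 8; 4];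
    [:: 0; 1; 5; 6; 2; 3; 7; 8; 4];
    [:: 2; 6; 11; 10; 5; 1; 0; 7; 3; 4; 8; 9];
    [:: 0; 1; 5; 9; 8; 4; 3; 7; 6; 2];
    [:: 4; 8; 9; 10; 5; 1; 0; 7; 3; 2; 6];
    [:: 0; 1; 5; 9; 13; 8; 4; 3; 7; 12; 11; 10; 6; 2]]);
  ([:: (1, 0); (5, 5)], [::
    [:: 2; 7; 0; 1; 6; 10; 5; 4; 9; 8; 3];
    [:: 2; 7; 11; 6; 1; 0; 8; 3; 4; 9; 10; 5];
    [:: 2; 7; 12; 8; 3; 4; 9; 0; 1; 6; 11; 10; 5];
    [:: 2; 7; 12; 11; 6; 1; 0; 10; 5; 4; 9; 13; 8; 3];
    [:: 9; 4; 5; 10; 6; 1; 0; 8; 3; 2; 7; 11];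
    [:: 10; 5; 4; 9; 0; 1; 6; 11; 7; 2; 3; 8; 12];
    [:: 2; 7; 11; 12; 8; 3; 4; 9; 0; 1; 6; 10; 5];
    [:: 2; 7; 0; 1; 6; 11; 10; 5; 4; 9; 8; 3];
    [:: 2; 7; 12; 11; 6; 1; 0; 8; 3; 4; 9; 10; 5];
    [:: 2; 7; 12; 13; 8; 3; 4; 9; 0; 1; 6; 11; 10; 5];
    [:: 0; 1; 6; 10; 5; 4; 9; 8; 3; 2; 7];
    [:: 0; 1; 6; 11; 7; 2; 3; 8; 9; 4; 5; 10];
    [:: 8; 3; 2; 7; 12; 11; 6; 1; 0; 9; 4; 5; 10];
    [:: 0; 1; 6; 11; 10; 5; 4; 9; 13; 8; 3; 2; 7; 12];
    [:: 12; 13; 8; 3; 2; 7; 11; 6; 1; 0; 10; 5; 4; 9; 14];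
    [:: 2; 7; 12; 13; 8; 3; 4; 9; 14; 15; 11; 0; 1; 6; 10; 5];
    [:: 6; 1; 0; 11; 12; 7; 2; 3; 8; 13; 9; 4; 5; 10; 14];
    [:: 0; 1; 6; 7; 2; 3; 8; 9; 4; 5; 10];
    [:: 0; 1; 6; 11; 10; 5; 4; 9; 8; 3; 2; 7]]);
  ([:: (1, 0); (5, 6)], [::
    [:: 3; 8; 12; 7; 2; 6; 11; 10; 5; 1; 0; 9; 4];
    [:: 0; 1; 5; 10; 14; 9; 4; 3; 8; 13; 12; 7; 2; 6; 11];
    [:: 0; 1; 5; 10; 15; 11; 6; 2; 7; 12; 13; 8; 3; 4; 9; 14]]);
  ([:: (4, 3); (5, 8)], [::
    [:: 0; 4; 9; 14; 10; 5; 1; 11; 6; 2; 12; 7; 3; 13; 8];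
    [:: 0; 4; 9; 14; 3; 7; 12; 1; 5; 10; 15; 11; 6; 2; 13; 8];
    [:: 0; 4; 9; 14; 2; 6; 11; 16; 12; 7; 3; 15; 10; 5; 1; 13; 8];
    [:: 0; 4; 9; 14; 1; 5; 10; 15; 2; 6; 11; 16; 3; 7; 12; 17; 13; 8];
    [:: 1; 5; 10; 14; 9; 4; 0; 11; 6; 2; 12; 7; 3; 13; 8];
    [:: 8; 13; 9; 4; 0; 11; 6; 2; 14; 3; 7; 12; 1; 5; 10; 15];
    [:: 1; 5; 10; 15; 3; 7; 12; 16; 11; 6; 2; 14; 9; 4; 0; 13; 8];
    [:: 8; 13; 9; 4; 0; 14; 1; 5; 10; 15; 2; 6; 11; 16; 3; 7; 12; 17];
    [:: 2; 6; 11; 0; 4; 9; 14; 10; 5; 1; 12; 7; 3; 13; 8];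
    [:: 0; 4; 9; 14; 10; 5; 1; 12; 7; 3; 15; 11; 6; 2; 13; 8];
    [:: 2; 6; 11; 16; 12; 7; 3; 15; 10; 5; 1; 14; 9; 4; 0; 13; 8];
    [:: 0; 4; 9; 14; 10; 5; 1; 15; 2; 6; 11; 16; 3; 7; 12; 17; 13; 8];
    [:: 3; 7; 12; 2; 6; 11; 1; 5; 10; 0; 4; 9; 13; 8];
    [:: 1; 5; 10; 14; 3; 7; 12; 2; 6; 11; 0; 4; 9; 13; 8];
    [:: 1; 5; 10; 15; 11; 6; 2; 14; 3; 7; 12; 0; 4; 9; 13; 8];
    [:: 3; 7; 12; 16; 11; 6; 2; 15; 10; 5; 1; 14; 9; 4; 0; 13; 8];
    [:: 8; 13; 9; 4; 0; 14; 1; 5; 10; 15; 11; 6; 2; 16; 3; 7; 12; 17];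
    [:: 0; 4; 9; 14; 10; 5; 1; 15; 2; 6; 11; 16; 12; 7; 3; 17; 13; 8];
    [:: 8; 13; 9; 4; 0; 14; 10; 5; 1; 15; 2; 6; 11; 16; 12; 7; 3; 17];
    [:: 0; 4; 9; 14; 10; 5; 1; 15; 11; 6; 2; 16; 12; 7; 3; 17; 13; 8];
    [:: 3; 7; 12; 2; 6; 11; 1; 5; 10; 0; 4; 9; 14; 13; 8];
    [:: 2; 6; 11; 1; 5; 10; 0; 4; 9; 14; 3; 7; 12; 13; 8];
    [:: 8; 13; 2; 6; 11; 0; 4; 9; 14; 15; 3; 7; 12; 1; 5; 10];
    [:: 2; 6; 11; 16; 3; 7; 12; 0; 4; 9; 14; 15; 10; 5; 1; 13; 8];
    [:: 8; 13; 9; 4; 0; 17; 12; 7; 3; 16; 11; 6; 2; 15; 10; 5; 1; 14];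
    [:: 1; 5; 10; 0; 4; 9; 14; 3; 7; 12; 11; 6; 2; 13; 8];
    [:: 3; 7; 12; 1; 5; 10; 15; 14; 2; 6; 11; 0; 4; 9; 13; 8];
    [:: 1; 5; 10; 14; 2; 6; 11; 16; 15; 3; 7; 12; 0; 4; 9; 13; 8];
    [:: 3; 7; 12; 17; 16; 11; 6; 2; 15; 1; 5; 10; 14; 9; 4; 0; 13; 8];
    [:: 0; 4; 9; 10; 5; 1; 11; 6; 2; 12; 7; 3; 13; 8];
    [:: 0; 4; 9; 14; 3; 7; 12; 1; 5; 10; 11; 6; 2; 13; 8];
    [:: 0; 4; 9; 14; 2; 6; 11; 12; 7; 3; 15; 10; 5; 1; 13; 8];
    [:: 0; 4; 9; 14; 1; 5; 10; 15; 2; 6; 11; 16; 3; 7; 12; 13; 8];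
    [:: 8; 13; 9; 4; 0; 14; 1; 5; 10; 15; 2; 6; 11; 16; 17; 3; 7; 12];
    [:: 8; 13; 9; 4; 0; 11; 6; 2; 3; 7; 12; 1; 5; 10; 14];
    [:: 3; 7; 12; 1; 5; 10; 14; 2; 6; 11; 15; 0; 4; 9; 13; 8];
    [:: 1; 5; 10; 14; 2; 6; 11; 15; 3; 7; 12; 16; 0; 4; 9; 13; 8];
    [:: 3; 7; 12; 17; 16; 11; 6; 2; 15; 1; 5; 10; 14; 0; 4; 9; 13; 8];
    [:: 8; 13; 9; 4; 0; 14; 1; 5; 10; 15; 11; 6; 2; 16; 17; 3; 7; 12];
    [:: 3; 7; 12; 17; 16; 2; 6; 11; 15; 1; 5; 10; 14; 0; 4; 9; 13; 8];
    [:: 8; 13; 3; 7; 12; 2; 6; 11; 1; 5; 10; 9; 4; 0; 14];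
    [:: 1; 5; 10; 15; 0; 4; 9; 14; 3; 7; 12; 11; 6; 2; 13; 8];
    [:: 8; 13; 12; 7; 3; 15; 10; 5; 1; 0; 4; 9; 14; 2; 6; 11; 16];
    [:: 0; 4; 9; 14; 10; 5; 1; 11; 6; 2; 3; 7; 12; 13; 8];
    [:: 0; 4; 9; 10; 5; 1; 12; 7; 3; 14; 15; 11; 6; 2; 13; 8];
    [:: 0; 4; 9; 14; 2; 6; 11; 12; 7; 3; 16; 15; 10; 5; 1; 13; 8];
    [:: 0; 4; 9; 10; 5; 1; 14; 15; 2; 6; 11; 16; 3; 7; 12; 17; 13; 8];
    [:: 3; 7; 12; 2; 6; 11; 1; 5; 10; 9; 4; 0; 13; 8];
    [:: 1; 5; 10; 9; 4; 0; 11; 6; 2; 12; 7; 3; 14; 13; 8];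
    [:: 1; 5; 10; 9; 4; 0; 12; 7; 3; 14; 15; 11; 6; 2; 13; 8];
    [:: 1; 5; 10; 14; 9; 4; 0; 16; 11; 6; 2; 15; 3; 7; 12; 13; 8];
    [:: 1; 5; 10; 9; 4; 0; 14; 15; 2; 6; 11; 16; 3; 7; 12; 17; 13; 8];
    [:: 2; 6; 11; 12; 7; 3; 14; 10; 5; 1; 0; 4; 9; 13; 8];
    [:: 0; 4; 9; 10; 5; 1; 12; 7; 3; 15; 11; 6; 2; 14; 13; 8];
    [:: 2; 6; 11; 12; 7; 3; 16; 15; 10; 5; 1; 14; 9; 4; 0; 13; 8];
    [:: 0; 4; 9; 14; 1; 5; 10; 15; 11; 6; 2; 3; 7; 12; 16; 17; 13; 8];
    [:: 2; 6; 11; 16; 1; 5; 10; 15; 0; 4; 9; 14; 18; 17; 3; 7; 12; 13; 8];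
    [:: 3; 7; 12; 16; 11; 6; 2; 15; 14; 10; 5; 1; 0; 4; 9; 13; 8];
    [:: 1; 5; 10; 9; 4; 0; 14; 15; 11; 6; 2; 16; 3; 7; 12; 17; 13; 8];
    [:: 0; 4; 9; 14; 10; 5; 1; 15; 11; 6; 2; 16; 17; 3; 7; 12; 13; 8];
    [:: 3; 7; 12; 2; 6; 11; 1; 5; 10; 9; 4; 0; 14; 13; 8];
    [:: 1; 5; 10; 15; 14; 9; 4; 0; 11; 6; 2; 3; 7; 12; 13; 8];
    [:: 1; 5; 10; 9; 4; 0; 12; 7; 3; 15; 16; 11; 6; 2; 14; 13; 8];
    [:: 0; 4; 9; 10; 5; 1; 11; 6; 2; 3; 7; 12; 13; 8];
    [:: 2; 6; 11; 1; 5; 10; 9; 4; 0; 14; 3; 7; 12; 13; 8];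
    [:: 2; 6; 11; 12; 7; 3; 15; 10; 5; 1; 0; 4; 9; 14; 13; 8];
    [:: 0; 4; 9; 10; 5; 1; 14; 2; 6; 11; 16; 15; 3; 7; 12; 13; 8];
    [:: 2; 6; 11; 15; 10; 5; 1; 14; 9; 4; 0; 17; 16; 3; 7; 12; 13; 8];
    [:: 1; 5; 10; 9; 4; 0; 14; 15; 11; 6; 2; 16; 12; 7; 3; 17; 18; 13; 8];
    [:: 2; 6; 11; 15; 1; 5; 10; 14; 9; 4; 0; 17; 16; 3; 7; 12; 13; 8]]);
  ([:: (1, 0)], [::
    [:: 0; 1];
    [:: 0; 1; 6; 2; 7; 3; 8; 4; 9; 5];
    [:: 0; 1; 5; 9; 4; 8; 3; 7; 2; 6];
    [:: 0; 1; 5; 10; 6; 2; 7; 3; 8; 4; 9];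
    [:: 2; 6; 0; 1; 5; 9; 4; 8; 3; 7];
    [:: 0; 1; 6; 5; 9; 4; 8; 3; 7; 2];
    [:: 0; 1; 5; 6; 2; 7; 3; 8; 4; 9];
    [:: 0; 1; 5; 9; 4; 8; 3; 7; 6; 2];
    [:: 0; 1; 6; 5; 9; 4; 8; 3; 2; 7];
    [:: 0; 1; 6; 2; 7; 3; 8; 9; 5; 4];
    [:: 0; 1; 2; 6; 7; 3; 8; 4; 9; 5];
    [:: 0; 1; 6; 5; 9; 4; 3; 8; 7; 2];
    [:: 0; 1; 2; 7; 6; 5; 9; 4; 8; 3];
    [:: 0; 1; 5; 4; 3; 7; 6; 2];
    [:: 0; 1; 6; 5; 9; 4; 8; 7; 3; 2];
    [:: 0; 1; 2; 6; 5; 9; 4; 8; 7; 3];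
    [:: 0; 1; 6; 5; 4; 9; 8; 3; 2; 7];
    [:: 0; 1; 5; 6; 7; 2; 3; 8; 9; 4];
    [:: 0; 1; 2; 6; 5; 4; 3; 7];
    [:: 0; 1; 2; 6; 5; 9; 4; 3; 8; 7];
    [:: 0; 1; 5; 9; 4; 3; 2; 6; 7; 8];
    [:: 0; 1; 6; 5; 4; 9; 8; 7; 2; 3];
    [:: 0; 1; 2; 3; 7; 6; 5; 4];
    [:: 0; 1; 6; 5; 9; 8; 7; 2; 3; 4];
    [:: 0; 1; 6; 2; 3; 4; 5; 9; 8; 7];
    [:: 0; 1; 6; 5; 4; 3; 2; 7; 8; 9];
    [:: 0; 1; 5; 6; 7; 8; 9; 4; 3; 2];
    [:: 0; 1; 2; 3; 4; 9; 8; 7; 6; 5]]);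
  ([:: (4, 3)], [::
    [:: 0; 4; 9; 3; 7; 1; 5; 10; 6; 2; 8];
    [:: 0; 4; 9; 2; 6; 11; 7; 3; 10; 5; 1; 8];
    [:: 0; 4; 9; 1; 5; 10; 2; 6; 11; 3; 7; 12; 8];
    [:: 0; 4; 8; 2; 6; 10; 5; 1; 7; 3; 9];
    [:: 0; 4; 8; 1; 5; 10; 3; 7; 11; 6; 2; 9];
    [:: 0; 4; 8; 12; 7; 3; 11; 6; 2; 10; 5; 1; 9];
    [:: 0; 4; 9; 5; 1; 7; 3; 10; 6; 2; 8];
    [:: 0; 4; 8; 1; 5; 9; 2; 6; 11; 7; 3; 10];
    [:: 0; 4; 9; 5; 1; 10; 2; 6; 11; 3; 7; 12; 8];
    [:: 0; 4; 8; 3; 7; 2; 6; 1; 5];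
    [:: 3; 7; 1; 5; 9; 4; 0; 6; 2; 8];
    [:: 0; 4; 8; 1; 5; 10; 6; 2; 9; 3; 7];
    [:: 0; 4; 8; 1; 5; 9; 2; 6; 10; 3; 7; 11];
    [:: 0; 4; 8; 12; 7; 3; 11; 6; 2; 10; 1; 5; 9];
    [:: 2; 6; 10; 3; 7; 0; 4; 9; 5; 1; 8];
    [:: 0; 4; 9; 1; 5; 10; 6; 2; 11; 7; 3; 12; 8];
    [:: 0; 4; 8; 13; 9; 5; 1; 10; 6; 2; 11; 7; 3; 12];
    [:: 0; 4; 8; 1; 5; 9; 2; 6; 10; 3; 7];
    [:: 0; 4; 8; 12; 7; 3; 11; 2; 6; 10; 1; 5; 9];
    [:: 0; 4; 8; 13; 9; 5; 1; 10; 6; 2; 12; 3; 7; 11];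
    [:: 0; 4; 9; 5; 1; 10; 6; 2; 11; 7; 3; 12; 8];
    [:: 0; 4; 9; 13; 3; 7; 11; 1; 5; 10; 6; 2; 12; 8];
    [:: 0; 4; 9; 3; 7; 8; 2; 6; 10; 5; 1];
    [:: 0; 4; 9; 8; 1; 5; 10; 3; 7; 11; 6; 2];
    [:: 0; 4; 8; 9; 1; 5; 10; 2; 6; 11; 3; 7; 12];
    [:: 0; 4; 8; 2; 6; 10; 9; 3; 7; 1; 5];
    [:: 0; 4; 8; 1; 5; 9; 2; 6; 11; 10; 3; 7];
    [:: 0; 4; 8; 12; 7; 3; 11; 6; 2; 10; 9; 1; 5];
    [:: 0; 4; 5; 1; 6; 2; 7; 3; 8];
    [:: 0; 4; 9; 3; 7; 1; 5; 6; 2; 8];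
    [:: 0; 4; 8; 7; 3; 9; 2; 6; 10; 5; 1];
    [:: 0; 4; 8; 1; 5; 9; 10; 3; 7; 11; 6; 2];
    [:: 0; 4; 8; 9; 1; 5; 10; 2; 6; 11; 7; 3; 12];
    [:: 0; 4; 8; 2; 6; 7; 3; 9; 5; 1];
    [:: 0; 4; 8; 1; 5; 10; 3; 7; 6; 2; 9];
    [:: 0; 4; 8; 7; 3; 11; 6; 2; 10; 5; 1; 9];
    [:: 0; 4; 8; 12; 3; 7; 11; 6; 2; 10; 9; 1; 5];
    [:: 0; 4; 5; 1; 10; 6; 2; 11; 7; 3; 12; 8; 13; 9];
    [:: 0; 4; 8; 7; 3; 10; 6; 2; 9; 5; 1];
    [:: 0; 4; 8; 12; 3; 7; 11; 6; 2; 10; 9; 5; 1];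
    [:: 0; 4; 9; 5; 1; 10; 6; 2; 11; 7; 3; 13; 12; 8];
    [:: 0; 4; 8; 12; 3; 7; 11; 2; 6; 10; 9; 1; 5];
    [:: 0; 4; 8; 9; 13; 3; 7; 12; 2; 6; 10; 5; 1; 11];
    [:: 0; 4; 9; 2; 6; 11; 10; 3; 7; 8; 1; 5];
    [:: 0; 4; 5; 1; 7; 3; 9; 10; 6; 2; 8];
    [:: 0; 4; 8; 9; 1; 5; 10; 2; 6; 11; 12; 7; 3];
    [:: 0; 4; 8; 3; 7; 6; 2; 1; 5];
    [:: 0; 4; 9; 8; 2; 6; 5; 1; 7; 3];
    [:: 0; 4; 5; 1; 7; 3; 10; 6; 2; 8; 9];
    [:: 0; 4; 8; 7; 3; 11; 6; 2; 9; 10; 5; 1];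
    [:: 0; 4; 8; 12; 7; 3; 11; 6; 2; 1; 5; 10; 9];
    [:: 0; 4; 5; 1; 7; 3; 9; 8; 2; 6];
    [:: 0; 4; 5; 1; 8; 7; 3; 9; 2; 6; 10];
    [:: 0; 4; 8; 7; 3; 11; 10; 5; 1; 9; 2; 6];
    [:: 0; 4; 8; 12; 7; 3; 11; 6; 2; 1; 5; 9; 10];
    [:: 0; 4; 9; 5; 1; 10; 11; 2; 6; 7; 3; 13; 8; 12];
    [:: 0; 4; 8; 1; 5; 6; 2; 9; 10; 3; 7];
    [:: 0; 4; 8; 7; 3; 11; 6; 2; 10; 9; 1; 5];
    [:: 0; 4; 8; 9; 1; 5; 10; 6; 2; 11; 12; 3; 7];
    [:: 0; 4; 5; 1; 10; 9; 13; 8; 12; 2; 6; 11; 7; 3];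
    [:: 0; 4; 8; 12; 3; 7; 11; 2; 6; 5; 1; 9; 10];
    [:: 0; 4; 5; 1; 10; 9; 13; 3; 7; 11; 6; 2; 12; 8];
    [:: 0; 4; 5; 1; 2; 6; 7; 3];
    [:: 1; 5; 4; 0; 6; 2; 8; 7; 3; 9; 10];
    [:: 0; 4; 8; 7; 3; 2; 6; 5; 1];
    [:: 2; 6; 5; 1; 0; 4; 9; 3; 7; 8];
    [:: 0; 4; 8; 9; 5; 1; 10; 2; 6; 7; 3; 11; 12]]);
  ([:: (5, 4)], [::
    [:: 0; 5; 10; 4; 9; 3; 8; 2; 7; 1; 6];
    [:: 0; 5; 10; 3; 8; 1; 6; 11; 4; 9; 2; 7];
    [:: 0; 5; 10; 2; 7; 12; 4; 9; 1; 6; 11; 3; 8];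
    [:: 0; 5; 10; 1; 6; 11; 2; 7; 12; 3; 8; 13; 4; 9];
    [:: 0; 5; 10; 6; 1; 7; 2; 8; 3; 9; 4];
    [:: 0; 5; 10; 3; 8; 1; 6; 11; 7; 2; 9; 4];
    [:: 0; 5; 10; 2; 7; 12; 8; 3; 11; 6; 1; 9; 4];
    [:: 0; 5; 9; 4; 13; 8; 3; 12; 7; 2; 11; 6; 1; 10];
    [:: 0; 5; 9; 4; 10; 3; 8; 2; 7; 1; 6];
    [:: 0; 5; 10; 6; 1; 8; 3; 11; 4; 9; 2; 7];
    [:: 0; 5; 9; 4; 12; 7; 2; 10; 1; 6; 11; 3; 8];
    [:: 0; 5; 10; 6; 1; 11; 2; 7; 12; 3; 8; 13; 4; 9];
    [:: 1; 6; 10; 4; 9; 5; 0; 7; 2; 8; 3];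
    [:: 0; 5; 9; 4; 11; 7; 2; 10; 3; 8; 1; 6];
    [:: 0; 5; 9; 4; 12; 8; 3; 11; 6; 1; 10; 2; 7];
    [:: 0; 5; 9; 4; 13; 8; 3; 12; 7; 2; 11; 1; 6; 10];
    [:: 3; 8; 2; 7; 1; 6; 0; 5; 9; 4];
    [:: 1; 6; 10; 3; 8; 2; 7; 0; 5; 9; 4];
    [:: 0; 5; 9; 4; 11; 3; 8; 1; 6; 10; 2; 7];
    [:: 0; 5; 9; 4; 12; 8; 3; 11; 7; 2; 10; 1; 6];
    [:: 0; 5; 10; 6; 1; 11; 7; 2; 12; 3; 8; 13; 4; 9];
    [:: 0; 5; 9; 4; 13; 3; 8; 12; 2; 7; 11; 6; 1; 10];
    [:: 0; 5; 10; 6; 1; 11; 7; 2; 12; 8; 3; 13; 4; 9];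
    [:: 0; 5; 10; 6; 1; 11; 7; 2; 12; 8; 3; 13; 9; 4];
    [:: 0; 5; 6; 1; 7; 2; 8; 3; 9; 4; 10];
    [:: 0; 5; 10; 3; 8; 1; 6; 7; 2; 9; 4; 11];
    [:: 0; 5; 10; 2; 7; 8; 3; 11; 6; 1; 9; 4; 12];
    [:: 0; 5; 10; 1; 6; 11; 2; 7; 12; 3; 8; 9; 4; 13];
    [:: 0; 5; 6; 1; 7; 2; 8; 3; 10; 4; 9];
    [:: 1; 6; 11; 4; 9; 8; 3; 10; 2; 7; 0; 5];
    [:: 0; 5; 10; 1; 6; 11; 3; 8; 9; 4; 12; 7; 2];
    [:: 0; 5; 9; 4; 13; 8; 3; 12; 7; 2; 11; 10; 1; 6];
    [:: 0; 5; 6; 1; 7; 2; 9; 4; 10; 3; 8];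
    [:: 0; 5; 6; 1; 8; 3; 10; 2; 7; 11; 4; 9];
    [:: 0; 5; 6; 1; 9; 4; 12; 8; 3; 11; 7; 2; 10];
    [:: 0; 5; 10; 6; 1; 11; 2; 7; 12; 3; 8; 9; 4; 13];
    [:: 0; 5; 6; 1; 7; 2; 8; 3; 9; 4];
    [:: 0; 5; 6; 1; 8; 3; 10; 4; 9; 2; 7];
    [:: 0; 5; 6; 1; 9; 4; 11; 7; 2; 10; 3; 8];
    [:: 0; 5; 6; 1; 10; 2; 7; 11; 3; 8; 12; 4; 9];
    [:: 0; 5; 9; 4; 13; 8; 3; 12; 2; 7; 11; 10; 1; 6];
    [:: 1; 6; 10; 3; 8; 7; 2; 9; 4; 0; 5];
    [:: 0; 5; 9; 4; 11; 3; 8; 7; 2; 10; 6; 1];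
    [:: 0; 5; 9; 4; 3; 8; 12; 7; 2; 11; 6; 1; 10];
    [:: 0; 5; 10; 6; 1; 11; 2; 7; 12; 8; 3; 4; 9; 13];
    [:: 0; 5; 9; 4; 13; 3; 8; 12; 2; 7; 11; 10; 1; 6];
    [:: 0; 5; 9; 4; 13; 3; 8; 12; 2; 7; 11; 10; 6; 1];
    [:: 0; 5; 10; 4; 9; 3; 8; 7; 2; 1; 6];
    [:: 0; 5; 6; 1; 8; 3; 10; 11; 4; 9; 2; 7];
    [:: 0; 5; 6; 1; 9; 4; 12; 7; 2; 10; 11; 3; 8];
    [:: 0; 5; 10; 1; 6; 11; 2; 7; 12; 13; 4; 9; 8; 3];
    [:: 0; 5; 6; 1; 7; 2; 8; 3; 10; 9; 4];
    [:: 0; 5; 6; 1; 8; 3; 10; 11; 7; 2; 9; 4];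
    [:: 0; 5; 6; 1; 10; 2; 7; 12; 4; 9; 8; 3; 11];
    [:: 0; 5; 9; 4; 13; 8; 3; 12; 7; 2; 1; 6; 11; 10];
    [:: 0; 5; 6; 1; 7; 2; 8; 3; 4; 9];
    [:: 0; 5; 9; 4; 10; 3; 8; 7; 2; 1; 6];
    [:: 0; 5; 6; 1; 8; 3; 11; 4; 9; 10; 2; 7];
    [:: 0; 5; 9; 4; 3; 8; 12; 7; 2; 10; 11; 6; 1];
    [:: 0; 5; 6; 1; 10; 9; 4; 13; 3; 8; 12; 7; 2; 11];
    [:: 1; 6; 5; 0; 4; 9; 2; 7; 8; 3; 10];
    [:: 0; 5; 6; 1; 8; 3; 11; 7; 2; 10; 9; 4];
    [:: 0; 5; 6; 1; 10; 9; 4; 12; 8; 3; 11; 7; 2];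
    [:: 0; 5; 6; 1; 10; 11; 2; 7; 12; 8; 3; 13; 9; 4];
    [:: 0; 5; 10; 6; 1; 11; 7; 2; 12; 8; 3; 4; 9; 14; 13];
    [:: 0; 5; 6; 1; 10; 11; 7; 2; 12; 8; 3; 13; 4; 9];
    [:: 0; 5; 6; 1; 10; 11; 7; 2; 12; 8; 3; 13; 9; 4];
    [:: 0; 5; 6; 1; 7; 2; 8; 3; 4; 9; 10];
    [:: 0; 5; 10; 9; 4; 11; 6; 1; 2; 7; 8; 3];
    [:: 0; 5; 6; 1; 9; 4; 12; 11; 3; 8; 7; 2; 10];
    [:: 0; 5; 6; 1; 10; 11; 2; 7; 12; 3; 8; 9; 4; 13];
    [:: 0; 5; 6; 1; 7; 2; 3; 8; 9; 4];
    [:: 0; 5; 6; 1; 2; 7; 8; 3; 10; 4; 9];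
    [:: 0; 5; 6; 1; 8; 3; 4; 9; 2; 7; 11; 10];
    [:: 0; 5; 6; 1; 9; 4; 12; 3; 8; 7; 2; 10; 11];
    [:: 0; 5; 6; 1; 10; 9; 4; 13; 8; 3; 12; 11; 7; 2];
    [:: 0; 5; 10; 6; 1; 11; 7; 2; 12; 13; 14; 4; 9; 8; 3];
    [:: 0; 5; 9; 4; 13; 3; 8; 12; 11; 10; 1; 6; 7; 2];
    [:: 0; 5; 6; 1; 2; 7; 8; 3; 4; 9];
    [:: 0; 5; 10; 9; 4; 3; 8; 7; 2; 1; 6]]);
  ([::], [::
    [:: 0];
    [:: 0; 4; 9; 5; 1; 6; 2; 7; 3; 8];
    [:: 0; 5; 1; 6; 2; 8; 4; 9; 3; 7];
    [:: 0; 4; 9; 5; 1; 7; 3; 8; 2; 6]])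
].

Definition bases : seq (seq (nat * nat) * seq nat) :=
  [seq (f.1, h) | f <- base_families, h <- f.2].

Definition base_ok (r : seq (nat * nat) * seq nat) :=
  [&& 0 < size r.2, perm_eq r.2 (iota 0 (size r.2)),
      all (fun s => growable s.1 s.2 r.2) r.1
    & all [in [:: 1; 4; 5]] (path_lengths r.2)].

(** The data on which the multisets reached from a base depend. *)
Definition profile (r : seq (nat * nat) * seq nat) :=
  let mult l := count_mem l (path_lengths r.2) in
  ([seq s.1 | s <- r.1], (mult 1, mult 4, mult 5)).

Lemma base_growable S h : base_ok (S, h) ->
  let: (X, (a, b, c)) := profile (S, h) in growable_multiset X (multiset145 a b c).
Proof.
case/and4P=> /= h_gt0 vert /allP grS /allP l145.
set L := multiset145 _ _ _.
have perm_L : perm_eq (path_lengths h) L.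
  have count_L l : l \in [:: 1; 4; 5] -> count_mem l (path_lengths h) == count_mem l L.
    rewrite !inE => /or3P[] /eqP->;
    by rewrite /L /multiset145 !count_cat !count_nseq /= ?mul0n ?mul1n ?addn0.
  apply/allP => l; rewrite mem_cat => /orP[/l145|l_in]; first exact: count_L.
  apply: count_L; move: l_in; rewrite !mem_cat !mem_nseq !inE.
  by case/or3P => /andP[_ ->]; rewrite ?orbT.
exists h; split=> //; first by rewrite -(perm_size perm_L) size_map size_edges prednK.
by move=> x /mapP[[y m] S_ym ->]; exists m; apply: (grS (y, m)).
Qed.

Definition covers a b c (p : seq nat * (nat * nat * nat)) :=
  let: (X, (a0, b0, c0)) := p in
  [&& attains X 8 1 a0 a, attains X 9 4 b0 b & attains X 11 5 c0 c].

(** The ranges are those of the three caps. *)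
Definition box_covered ps :=
  all (fun a => all (fun b => all (fun c => possible a b c ==> has (covers a b c) ps)
    (iota 0 (11 + 5))) (iota 0 (9 + 4))) (iota 0 (8 + 1)).

Lemma bases_ok : all base_ok bases.
Proof. by vm_compute. Qed.

Lemma bases_cover : box_covered (map profile bases).
Proof. by vm_compute. Qed.

Theorem theorem3p3 (a b c v : nat) :
  admissible v (nseq a 1 ++ nseq b 4 ++ nseq c 5) ->
  exists h : seq 'I_v, realization (nseq a 1 ++ nseq b 4 ++ nseq c 5) h.
Proof.
move=> adm; have [vE _ _] := adm.
have /possible_cap poss := admissible_possible adm.
have /allP/(_ _ (@cap_mem 8 1 a isT))/allP/(_ _ (@cap_mem 9 4 b isT)) := bases_cover.
move=> /allP/(_ _ (@cap_mem 11 5 c isT)); rewrite poss => /hasP[_ /mapP[[S h] base_h ->]].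
case/and3P=> /attains_cap[i [aE Xi]] /attains_cap[j [bE Xj]] /attains_cap[k [cE Xk]].
have gr_h := base_growable (allP bases_ok _ base_h).
apply: (@growable_multiset_realization [seq s.1 | s <- S]) => //.
by have := growable_multiset145 Xi Xj Xk gr_h; rewrite -aE -bE -cE.
Qed.
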